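(* Let $l\ge 1$ and let $G$ be a group acting isometrically, non-elliptically and non-horocyclically on each of finitely many Gromov-hyperbolic spaces $X_1,\ldots,X_l$. Then the set $$\mathcal{SH}(G)=\{g\in G:\ g \text{ is hyperbolic on } X_i \text{ for every } 1\le i\le l\}$$ is not empty.
   Context: A Gromov-hyperbolic space is a geodesic metric space $X$ that is $\delta$-hyperbolic for some $\delta\ge 0$: every side of every geodesic triangle lies in the $\delta$-neighborhood of the union of the other two sides. No properness of the space or of the action is assumed. $\partial X$ denotes the Gromov boundary (equivalence classes of sequences $(x_n)$ in $X$ converging at infinity, defined through Gromov products). For an isometric action $G\curvearrowright X$ with basepoint $x_0$, the limit set is $\Lambda(G)=\{[(x_n)]\in\partial X: \exists\, g_n\in G \text{ with } x_n=g_n x_0\}$. The action is elliptic if $|\Lambda(G)|=0$ (equivalently, orbits are bounded) and horocyclic (parabolic) if $|\Lambda(G)|=1$ (equivalently, orbits are unbounded and $G$ contains no hyperbolic element). An action is non-elliptic and non-horocyclic if and only if $G$ contains at least one hyperbolic element for it. An element $g\in G$ is elliptic on $X$ if the orbits of $\langle g\rangle$ in $X$ are bounded; otherwise $g$ is hyperbolic on $X$ if it has exactly two fixed points on $\partial X$ and parabolic if it has exactly one. *)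

(* Defs.v *)
From HB Require Import structures.
From mathcomp Require Import all_boot all_order all_algebra.
From mathcomp Require Import all_classical all_reals all_analysis.

Set Implicit Arguments.
Unset Strict Implicit.
Unset Printing Implicit Defensive.

Import Order.TTheory GRing.Theory Num.Theory.
Import numFieldNormedType.Exports.

Local Open Scope classical_set_scope.
Local Open Scope card_scope.
Local Open Scope ring_scope.

Section GromovHyperbolicSpace.
Context {R : realType} (X : metricType R).

Definition is_geodesic (x y : X) (c : R -> X) : Prop :=
  [/\ c 0 = x, c (mdist x y) = y &
      {in `[0, mdist x y]%R &, forall s t, mdist (c s) (c t) = `|s - t|}].

Definition is_geodesic_segment (x y : X) (S : set X) : Prop :=
  exists2 c, is_geodesic x y c & S = c @` `[0, mdist x y].

Definition geodesic_space : Prop :=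
  forall x y : X, exists S, is_geodesic_segment x y S.

(* The neighborhood is the closed one; only the existence of some delta
   matters below, and 0 is allowed. *)
Definition neighborhood (delta : R) (S : set X) : set X :=
  [set p | exists2 q, S q & mdist p q <= delta].

(* One inclusion is enough: cyclically permuting the vertices gives the other
   two sides of the triangle. *)
Definition delta_hyperbolic (delta : R) : Prop :=
  forall (x y z : X) (A B C : set X),
    is_geodesic_segment x y A -> is_geodesic_segment y z B ->
    is_geodesic_segment z x C ->
    A `<=` neighborhood delta (B `|` C).

Definition gromov_hyperbolic : Prop :=
  geodesic_space /\ exists2 delta : R, 0 <= delta & delta_hyperbolic delta.

End GromovHyperbolicSpace.

Section GromovBoundary.
Context {R : realType} {X : metricType R}.

Definition gromov_product (o x y : X) : R :=
  2^-1 * (mdist x o + mdist y o - mdist x y).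

(* (x_m | y_n)_o tends to infinity as m and n tend independently to infinity *)
Definition gromov_diverge (o : X) (x y : nat -> X) : Prop :=
  gromov_product o (x p.1) (y p.2) @[p --> (\oo, \oo)] --> +oo.

Definition converges_at_infinity (o : X) (x : nat -> X) : Prop :=
  gromov_diverge o x x.

Definition boundary_class (o : X) (x : nat -> X) : set (nat -> X) :=
  [set y | converges_at_infinity o y /\ gromov_diverge o x y].

(* A boundary point is the set of all the sequences representing it.  Changing
   o changes Gromov products by a bounded amount, so this does not depend on
   o. *)
Definition gromov_boundary (o : X) : set (set (nat -> X)) :=
  boundary_class o @` converges_at_infinity o.

End GromovBoundary.

Record isometric_action {R : realType} (G : groupType) (X : metricType R) :=
  IsometricAction {
    act :> G -> X -> X ;
    act1 : forall x, act 1%g x = x ;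
    actM : forall g h x, act (g * h)%g x = act g (act h x) ;
    act_isometry : forall g x y, mdist (act g x) (act g y) = mdist x y
  }.

Section Actions.
Context {R : realType} {G : groupType} {X : metricType R}.
Variables (a : isometric_action G X) (x0 : X).

Definition limit_set : set (set (nat -> X)) :=
  [set boundary_class x0 x | x in
    [set x | converges_at_infinity x0 x /\
             exists g : nat -> G, forall n, x n = a (g n) x0]].

Definition elliptic_action : Prop := limit_set #= `I_0.

Definition horocyclic_action : Prop := limit_set #= `I_1.

(* The action of g on the boundary maps [(x_n)] to [(g x_n)]; on classes seen
   as sets of sequences this is the direct image. *)
Definition boundary_act (g : G) (xi : set (nat -> X)) : set (nat -> X) :=
  [set (fun n => a g (x n)) | x in xi].

Definition boundary_fixed_points (g : G) : set (set (nat -> X)) :=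
  [set xi | gromov_boundary x0 xi /\ boundary_act g xi = xi].

Definition cyclic_subgroup (g : G) : set G :=
  [set h | exists n : nat, h = (g ^+ n)%g \/ h = (g ^- n)%g].

Definition elliptic_element (g : G) : Prop :=
  forall x : X, exists M : R, forall h k : G,
    cyclic_subgroup g h -> cyclic_subgroup g k -> mdist (a h x) (a k x) <= M.

Definition hyperbolic_element (g : G) : Prop :=
  ~ elliptic_element g /\ boundary_fixed_points g #= `I_2.

End Actions.

Definition simultaneously_hyperbolic {R : realType} {G : groupType} {l : nat}
    {X : 'I_l -> metricType R} (a : forall i, isometric_action G (X i))
    (x0 : forall i, X i) : set G :=
  [set g | forall i, hyperbolic_element (a i) (x0 i) g].

(* Main.v *)
Require Import Defs.
From HB Require Import structures.
From mathcomp Require Import all_boot all_order all_algebra.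
From mathcomp Require Import all_classical all_reals all_analysis.
From mathcomp Require Import lra.

Set Implicit Arguments.
Unset Strict Implicit.
Unset Printing Implicit Defensive.

Import Order.TTheory GRing.Theory Num.Theory.

Local Open Scope classical_set_scope.
Local Open Scope card_scope.
Local Open Scope ring_scope.

(* Call g loxodromic when d(x, g^n x) grows at least linearly; by the four-point
   inequality this holds as soon as d(x, g^2 x) exceeds d(x, g x) by a multiple
   of the hyperbolicity constant at some x.  Two elements of orbits converging
   to distinct limit points produce, by ping-pong, a loxodromic element on each
   space.  To combine them, let g be loxodromic on X_1, ..., X_k but not on
   X_(k+1), where h is.
   - On X_1, ..., X_k, the product g^n f is loxodromic for all large n unless
     f sends the attracting end of g to the repelling one, and some power h^d
     is such that no h^(d j) does so on any of these spaces.
   - On X_(k+1), the hyperbolic analogue of the trace identity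
     tr (g^2 h) + tr h = tr g * tr (g h) shows that g h^m or g^2 h^m is
     loxodromic for every large m and every non-loxodromic g: otherwise g and
     g h^m would have a common almost fixed point.  The bound on m is uniform in
     g, so this can be applied to g^n, where n is chosen after m. *)

(** * Gromov products and the four-point inequality *)

Section FourPoint.
Context {R : realType} {X : metricType R}.
Implicit Types (o p x y z : X) (D t : R).

Definition four_point D : Prop := forall o x y z,
  gromov_product o x y - D <= gromov_product o x z \/
  gromov_product o y z - D <= gromov_product o x z.

Lemma gromov_productC o x y : gromov_product o x y = gromov_product o y x.
Proof. by rewrite /gromov_product (metric_sym x y) [_ + mdist y o]addrC. Qed.

Lemma gromov_product_le o x y : gromov_product o x y <= mdist x o.
Proof.
rewrite /gromov_product; have := metric_triangle y x o.
by rewrite (metric_sym y x); lra.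
Qed.

Lemma gromov_product_lip o x y y' :
  gromov_product o x y - mdist y y' <= gromov_product o x y'.
Proof.
rewrite /gromov_product; have := metric_triangle y y' o.
by have := metric_triangle x y y'; lra.
Qed.

(** The first alternative of [four_point] would give [K <= gromov_product o x z], so the second
    holds. Replacing [x] by the nearby direction [y] thus costs one [D]. *)
Lemma four_pointP D o x y z K : four_point D ->
  gromov_product o x z < K -> K + D <= gromov_product o x y ->
  gromov_product o y z < K + D.
Proof. by move=> /(_ o x y z) h4 xz xy; case: h4; lra. Qed.

Lemma geodesic_segment_dist x y (S : set X) p : is_geodesic_segment x y S ->
  S p -> mdist x p + mdist p y = mdist x y.
Proof.
move=> [c [c0 c1 ci] ->] [s /= /[dup] Is]; rewrite in_itv /= => /andP[s0 s1] <-.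
have I0 : 0 \in `[0, mdist x y]%R by rewrite in_itv /= lexx mdist_ge0.
have I1 : mdist x y \in `[0, mdist x y]%R by rewrite in_itv /= lexx mdist_ge0.
rewrite -[in mdist x _]c0 -[in mdist _ y]c1 !ci// sub0r normrN distrC.
by rewrite !ger0_norm ?subr_ge0//; lra.
Qed.

Lemma geodesic_segment_point x y (S : set X) t : is_geodesic_segment x y S ->
  0 <= t -> t <= mdist x y -> exists2 p, S p & mdist x p = t.
Proof.
move=> [c [c0 c1 ci] ->] t0 t1.
have I0 : 0 \in `[0, mdist x y]%R by rewrite in_itv /= lexx mdist_ge0.
have It : t \in `[0, mdist x y]%R by rewrite in_itv /= t0.
exists (c t); first by exists t.
by rewrite -[in LHS]c0 ci// sub0r normrN ger0_norm.
Qed.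

Lemma geodesic_point x y t : geodesic_space X -> 0 <= t -> t <= mdist x y ->
  exists2 p, mdist x p = t & mdist p y = mdist x y - t.
Proof.
move=> /(_ x y)[S Sxy] t0 txy;
  have [p Sp xp] := geodesic_segment_point Sxy t0 txy.
by exists p => //; have := geodesic_segment_dist Sxy Sp; rewrite xp; lra.
Qed.

(* The point of [x, z] at distance (w | z)_x from x is within
   (x | z)_w + 2 delta of w, and every point of [x, z] is delta-close to
   [x, y] or [y, z], all of whose points are at distance at least (x | y)_w,
   resp. (y | z)_w, from w. *)
Lemma delta_hyperbolic_four_point (delta : R) : geodesic_space X ->
  delta_hyperbolic X delta -> four_point (3 * delta).
Proof.
move=> geo hyp w x y z.
have [A Axz] := geo x z; have [B Bzw] := geo z w; have [C Cwx] := geo w x.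
have [B' Bzy] := geo z y; have [C' Cyx] := geo y x.
have [p Ap xp] : exists2 p, A p & mdist x p = gromov_product x w z.
  apply: (geodesic_segment_point Axz); rewrite /gromov_product.
    have := metric_triangle w x z; have := metric_sym x z.
    by lra.
  have := metric_triangle w z x; have := metric_sym z w; have := metric_sym x z.
  by lra.
have pz := geodesic_segment_dist Axz Ap.
have wp : mdist p w <= gromov_product w x z + 2 * delta.
  have [q [Bq|Cq] pq] := hyp _ _ _ _ _ _ Axz Bzw Cwx p Ap.
    have := geodesic_segment_dist Bzw Bq.
    have := metric_triangle p q w; have := metric_triangle z q p.
    have := metric_triangle p q z.
    move: xp pz pq; rewrite /gromov_product.
    have := metric_sym z x; have := metric_sym w x; have := metric_sym q p;
      have := metric_sym q z.
    by have := metric_sym w z; have := metric_sym z p; lra.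
  have := geodesic_segment_dist Cwx Cq.
  have := metric_triangle p q w; have := metric_triangle x q p.
  have := metric_triangle p q x.
  move: xp pz pq; rewrite /gromov_product.
  have := metric_sym z x; have := metric_sym w x; have := metric_sym q p;
    have := metric_sym q x.
  by have := metric_sym w q; have := metric_sym x p; have := metric_sym w z;
    lra.
have [q [Bq|Cq] pq] := hyp _ _ _ _ _ _ Axz Bzy Cyx p Ap; [right|left].
  have := geodesic_segment_dist Bzy Bq; move: wp pq; rewrite /gromov_product.
  have := metric_triangle y q w; have := metric_triangle z q w.
  have := metric_triangle q p w.
  by have := metric_sym q p; have := metric_sym q y; have := metric_sym z y;
    lra.
have := geodesic_segment_dist Cyx Cq; move: wp pq; rewrite /gromov_product.
have := metric_triangle y q w; have := metric_triangle x q w.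
have := metric_triangle q p w.
by have := metric_sym q p; have := metric_sym q x; have := metric_sym y x; lra.
Qed.

End FourPoint.

(** * Displacement of powers and linear growth *)

Section Isometry.
Context {R : realType} {G : groupType} {X : metricType R}.
Variable a : isometric_action G X.
Implicit Types (f g h : G) (x y : X) (n : nat).

Lemma mdist_actV g x y : mdist (a g^-1%g x) y = mdist x (a g y).
Proof. by rewrite -(act_isometry a g) -actM mulgV act1. Qed.

Lemma mdist_expS g x n :
  mdist (a (g ^+ n.+1)%g x) x <= mdist (a (g ^+ n)%g x) x + mdist (a g x) x.
Proof.
rewrite expgSr actM; have :=
  metric_triangle (a (g ^+ n)%g (a g x)) (a (g ^+ n)%g x) x.
by rewrite act_isometry; lra.
Qed.

Lemma mdist_expD g x m n :
  mdist (a (g ^+ (m + n))%g x) (a (g ^+ m)%g x) = mdist (a (g ^+ n)%g x) x.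
Proof. by rewrite expgnDr actM act_isometry. Qed.

Lemma mdist_exp_le g x n : mdist (a (g ^+ n)%g x) x <= n%:R * mdist (a g x) x.
Proof.
elim: n => [|n IHn]; first by rewrite expg0 act1 mdistxx mul0r.
by rewrite -natr1; have := mdist_expS g x n; lra.
Qed.

Definition loxodromic x g : Prop := exists c B : R,
  0 < c /\ forall n, c * n%:R - B <= mdist (a (g ^+ n)%g x) x.

Lemma loxodromic_base x y g : loxodromic x g -> loxodromic y g.
Proof.
move=> [c [B [c0 cB]]]; exists c, (B + 2 * mdist x y); split=> // n.
have := cB n; have := metric_triangle (a (g ^+ n)%g x) (a (g ^+ n)%g y) x.
by rewrite act_isometry; have := metric_triangle (a (g ^+ n)%g y) y x;
   have := metric_sym y x; lra.
Qed.

(** Write [n = q * m + r]: the remainder contributes at most [m] times the displacement of [g], and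
    rounding [n / m] down to [q] loses at most [c]. *)
Lemma loxodromic_root x g m : (0 < m)%N ->
  loxodromic x (g ^+ m)%g -> loxodromic x g.
Proof.
move=> m0 [c [B [c0 cB]]]; have mR : 0 < m%:R :> R by rewrite ltr0n.
exists (c / m%:R), (B + c + m%:R * mdist (a g x) x); split;
  first exact: divr_gt0.
move=> n; rewrite (divn_eq n m); set q := (n %/ m)%N; set r := (n %% m)%N.
have rm : r%:R <= m%:R :> R by rewrite ler_nat ltnW// ltn_pmod.
have cr : c / m%:R * (q * m + r)%:R <= c * q%:R + c.
  rewrite natrD natrM mulrDr [q%:R * _]mulrC mulrA divfK ?gt_eqF// lerD2l.
  by rewrite mulrAC -mulrA ger_pMr// ler_pdivrMr ?mul1r.
have := cB q; rewrite -expgnA mulnC.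
have := metric_triangle (a (g ^+ (q * m))%g x) (a (g ^+ (q * m + r))%g x) x.
rewrite [mdist (a _ _) (a _ _)]metric_sym mdist_expD.
have := mdist_exp_le g x r; have := ler_wpM2r (mdist_ge0 (a g x) x) rm.
by lra.
Qed.

(** Since [h ^+ (m * j)] moves [y] at most [j] times as far as [h ^+ m] does, dividing by [j] and
    taking [j] large removes both [B] and the dependence on [y]. *)
Lemma loxodromic_displacement x h : loxodromic x h ->
  exists2 c, 0 < c & forall m y, c * m%:R <= mdist (a (h ^+ m)%g y) y.
Proof.
move=> [c [B [c0 cB]]]; exists c => // m y; rewrite leNgt; apply/negP => lt.
set e := c * m%:R - mdist (a (h ^+ m)%g y) y.
have e0 : 0 < e by rewrite /e; lra.
have := truncnS_gt ((B + 2 * mdist x y) / e); set j := (Num.truncn _).+1.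
rewrite ltr_pdivrMr// => jB.
have := cB (m * j)%N; rewrite expgnA natrM.
have := mdist_exp_le (h ^+ m)%g y j.
have := metric_triangle (a (h ^+ m ^+ j)%g x) (a (h ^+ m ^+ j)%g y) x.
rewrite act_isometry; have := metric_triangle (a (h ^+ m ^+ j)%g y) y x.
have := metric_sym y x; move: jB;
  rewrite /e mulrBr [_ * (c * _)]mulrCA (mulrC j%:R).
by lra.
Qed.

(** Failure of the long-square criterion at every point: the form in which not being loxodromic
    enters the estimates. *)
Definition short_square D g : Prop :=
  forall x, mdist (a (g ^+ 2)%g x) x <= mdist (a g x) x + 2 * D.

(* With a_n = d(x, g^n x), the four points x, g x, g^2 x, g^(n+2) x give
   a_2 + a_(n+1) <= max (a_1 + a_n, a_1 + a_(n+2)) + 2 D, so a_(n+1) > a_n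
   propagates. *)
Lemma mdist_exp_growth D x g c : four_point (X := X) D -> 0 < c ->
  mdist (a g x) x + 2 * D + c <= mdist (a (g ^+ 2)%g x) x -> 0 <= D ->
  forall n, mdist (a (g ^+ n.+1)%g x) x + c <= mdist (a (g ^+ n.+2)%g x) x.
Proof.
move=> fp c0 gap D0; elim=> [|n IHn].
  by rewrite expg1; lra.
have := fp (a (g ^+ n.+3)%g x) x (a g x) (a (g ^+ 2)%g x).
rewrite /gromov_product.
have -> : mdist (a g x) (a (g ^+ n.+3)%g x) = mdist (a (g ^+ n.+2)%g x) x.
  by rewrite expgS actM act_isometry metric_sym.
have -> : mdist (a (g ^+ 2)%g x) (a (g ^+ n.+3)%g x) = mdist (a (g ^+ n.+1)%g
  x) x.
  by rewrite metric_sym -(mdist_expD g x 2).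
have -> : mdist (a g x) (a (g ^+ 2)%g x) = mdist (a g x) x.
  by rewrite expg2 actM act_isometry metric_sym.
rewrite (metric_sym x (a g x)) (metric_sym x (a (g ^+ 2)%g x)).
rewrite (metric_sym x (a (g ^+ n.+3)%g x)).
by case; lra.
Qed.

Lemma loxodromic_of_long_square D x g : four_point (X := X) D -> 0 <= D ->
  mdist (a g x) x + 2 * D < mdist (a (g ^+ 2)%g x) x -> loxodromic x g.
Proof.
move=> fp D0 lt; pose c := mdist (a (g ^+ 2)%g x) x - mdist (a g x) x - 2 * D.
have c0 : 0 < c by rewrite /c; lra.
have gr := @mdist_exp_growth D x g c fp c0 _ D0; exists c, c; split=> //.
have {gr} : forall n, mdist (a (g ^+ n.+1)%g x) x + c <= mdist (a (g ^+ n.+2)%g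
  x) x.
  by apply: gr; rewrite /c; lra.
move=> gr; case=> [|n]; first by rewrite mulr0 expg0 act1 mdistxx; lra.
elim: n => [|n IHn]; first by rewrite mulr1 subrr mdist_ge0.
by have := gr n; move: IHn; rewrite -(natr1 n.+1); lra.
Qed.

Lemma short_squareP D x g : four_point (X := X) D -> 0 <= D ->
  ~ loxodromic x g -> short_square D g.
Proof.
move=> fp D0 nlox y; rewrite leNgt; apply/negP => lt; apply: nlox.
exact/(@loxodromic_base y)/(loxodromic_of_long_square fp).
Qed.

Lemma short_square_conj D f g : short_square D (f * g)%g -> short_square D (g *
  f)%g.
Proof.
move=> sfg x; have := sfg (a g^-1%g x).
rewrite -(act_isometry a g) -[mdist (a (f * g)%g _) _](act_isometry a g).
by rewrite -!actM !expg2 !mulgA !mulgK mulgV act1.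
Qed.

End Isometry.

(** * Ping-pong and common almost fixed points *)

Section HyperbolicIsometry.
Context {R : realType} {G : groupType} {X : metricType R}.
Variable a : isometric_action G X.
Variable D : R.
Hypotheses (fp : four_point (X := X) D) (D0 : 0 <= D).
Implicit Types (f g h : G) (x y p : X) (n : nat) (K t : R).

Lemma mdist_inv g x : mdist (a g^-1%g x) x = mdist (a g x) x.
Proof. by rewrite mdist_actV metric_sym. Qed.

(** Under [short_square], the right side is at least half the displacement minus [D]: [g x] and
    [g^-1 x] then leave [x] in the same direction. *)
Lemma gromov_product_inv g x : gromov_product x (a g x) (a g^-1%g x) =
  mdist (a g x) x - 2^-1 * mdist (a (g ^+ 2)%g x) x.
Proof.
rewrite /gromov_product mdist_inv [mdist (a g x) (a _ x)]metric_sym mdist_actV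
  -actM -expg2.
by rewrite (metric_sym x); lra.
Qed.

(** The points [f^-1 x] and [f g x] lie in the direction of [f x], while [g^-1 x] and [(f g)^-1 x]
    lie in that of [g x]. Three exchanges by [four_pointP] bound the product of [f g x] and
    [(f g)^-1 x] by [K + 3 * D], so the square is long once [f g] moves [x] by more than
    [2 * K + 8 * D]; the two displacement bounds ensure this. *)
Lemma ping_pong x f g K : short_square a D f -> short_square a D g ->
  gromov_product x (a f x) (a g x) < K ->
  2 * K + 5 * D <= mdist (a f x) x -> 2 * K + 5 * D <= mdist (a g x) x ->
  mdist (a (f * g)%g x) x + 2 * D < mdist (a ((f * g) ^+ 2)%g x) x.
Proof.
have D_ge0 := D0; move=> /(_ x) sf /(_ x) sg fgK fK gK.
have := gromov_product_inv f x; have := gromov_product_inv g x => gV fV.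
have s1 : gromov_product x (a f^-1%g x) (a g x) < K + D.
  by apply: four_pointP fgK _ => //; lra.
have s2 : gromov_product x (a g^-1%g x) (a f x) < K + D.
  by rewrite gromov_productC in fgK; apply: four_pointP fgK _ => //; lra.
have dfg : mdist (a (f * g)%g x) x = mdist (a f x) x + mdist (a g x) x
    - 2 * gromov_product x (a f^-1%g x) (a g x).
  rewrite /gromov_product mdist_inv (mdist_actV a f x) -actM (metric_sym x).
  by lra.
have s3 : gromov_product x (a f x) (a (f * g)%g x) =
    2^-1 * (mdist (a (f * g)%g x) x + mdist (a f x) x - mdist (a g x) x).
  rewrite /gromov_product [in mdist _ (a (f * g)%g x)]actM (act_isometry a f).
  by rewrite (metric_sym x); lra.
have s4 : gromov_product x (a g^-1%g x) (a (f * g)^-1%g x) =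
    2^-1 * (mdist (a (f * g)%g x) x + mdist (a g x) x - mdist (a f x) x).
  rewrite /gromov_product !mdist_inv invgM (actM a g^-1%g) (act_isometry a
    g^-1%g).
  by rewrite (metric_sym x) mdist_inv; lra.
have s5 : gromov_product x (a (f * g)%g x) (a g^-1%g x) < K + D + D.
  by rewrite gromov_productC in s2; apply: four_pointP s2 _ => //; lra.
have s6 : gromov_product x (a (f * g)^-1%g x) (a (f * g)%g x) < K + D + D + D.
  by rewrite gromov_productC in s5; apply: four_pointP s5 _ => //; lra.
by rewrite gromov_productC gromov_product_inv in s6; lra.
Qed.

(** As [g] has a short square, [p] is also almost on the way from [x] to [g^-1 x]. Hence [p] and
    [g p] are almost on [[x, g x]], each at distance [t] from one end. *)
Lemma mdist_move g x p t : short_square a D g ->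
  mdist x p = t -> 2 * t <= mdist (a g x) x ->
  mdist p (a g x) <= mdist (a g x) x - t + 2 * D ->
  mdist p (a g p) <= mdist (a g x) x - 2 * t + 8 * D.
Proof.
have D_ge0 := D0; move=> /(_ x) sg xp t2 pg.
have gV := gromov_product_inv g x.
have pV : mdist p (a g^-1%g x) <= mdist (a g x) x - t + 4 * D.
  have := fp x p (a g x) (a g^-1%g x); rewrite gV /gromov_product mdist_inv.
  by rewrite (metric_sym p x) xp => -[]; lra.
rewrite metric_sym mdist_actV in pV.
have := fp (a g x) p x (a g p).
rewrite /gromov_product !act_isometry (metric_sym x (a g x)) (metric_sym p x)
  xp.
by case; lra.
Qed.

(* Take x almost minimizing the larger displacement.  Moving x by 5 D along
   [x, f x] would decrease it, unless f and g move x by comparable amounts in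
   different directions; then f g is loxodromic by ping-pong. *)
Lemma near_common_fixed_point x0 f g : geodesic_space X -> 0 < D ->
  short_square a D f -> short_square a D g -> short_square a D (f * g)%g ->
  exists2 x, mdist (a f x) x <= 30 * D & mdist (a g x) x <= 30 * D.
Proof.
move=> geo Dpos sf sg sfg.
pose F f g x := Num.max (mdist (a f x) x) (mdist (a g x) x).
pose E := [set F f g x | x in [set: X]].
have Elb : has_lbound E.
  by exists 0 => _ [y _ <-]; rewrite le_max mdist_ge0.
have [_ [x _ <-] Fx] : exists2 e, E e & e < inf E + D.
  by apply: inf_adherent => //; split=> //; exists (F f g x0), x0.
have Fmin p : F f g x - D < F f g p.
  by have : inf E <= F f g p; [apply: ge_inf => //; exists p | lra].
suff Fle : F f g x <= 30 * D.
  by exists x; apply: le_trans Fle; rewrite le_max lexx ?orbT.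
clear E Elb Fx; rewrite leNgt; apply/negP => Fbig.
wlog fg : f g sf sg sfg Fmin Fbig / mdist (a g x) x <= mdist (a f x) x.
  move=> W; case: (leP (mdist (a g x) x) (mdist (a f x) x)) => [|/ltW] le.
    exact: (W f g).
  apply: (W g f) => //; first exact: short_square_conj.
    by move=> p; rewrite /F 2!(maxC (mdist (a g _) _)); exact: Fmin.
  by rewrite /F maxC.
have FE : F f g x = mdist (a f x) x by rewrite /F; apply/max_idPl.
rewrite FE in Fbig Fmin.
have contra p : mdist p (a f p) <= mdist (a f x) x - 2 * D ->
    mdist p (a g p) <= mdist (a f x) x - 2 * D -> False.
  move=> pf pg; have := Fmin p; rewrite /F lt_max 2!(metric_sym _ p).
  by case/orP; lra.
(* With [t = 5 * D], [mdist_move] saves [10 * D - 8 * D = 2 * D], more than the slack [D] in the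
   choice of [x]. *)
have [p xp pf] : exists2 p, mdist x p = 5 * D & mdist p (a f x) = mdist x (a f
  x) - 5 * D.
  by apply: geodesic_point => //; rewrite ?(metric_sym x); lra.
rewrite (metric_sym x) in pf.
have pfp : mdist p (a f p) <= mdist (a f x) x - 2 * D.
  have := @mdist_move f x p (5 * D) sf xp.
  by rewrite pf => M; apply: le_trans (M _ _) _; lra.
(* Moving the point by [5 * D] raises the displacement of [g] by at most [10 * D], so a margin of
   [12 * D] leaves the required [2 * D]. *)
have [gle|glt] := leP (mdist (a g x) x) (mdist (a f x) x - 12 * D).
  apply: (contra p) => //.
  have := metric_triangle p x (a g p);
    have := metric_triangle x (a g x) (a g p).
  by rewrite act_isometry (metric_sym p x) (metric_sym x (a g x)) xp; lra.
have [fgK|fgbig] := ltP (gromov_product x (a f x) (a g x)) (5 * D).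
  have := sfg x; rewrite leNgt => /negP; apply.
  by apply: (ping_pong sf sg fgK); lra.
(* Here [f x] and [g x] share their direction up to distance [5 * D], so [p] is almost on [[x, g x]]
   too. *)
apply: (contra p) => //; have := @mdist_move g x p (5 * D) sg xp.
move=> M; apply: le_trans (M _ _) _; [lra| |lra].
have := fp x p (a f x) (a g x); move: fgbig; rewrite /gromov_product.
by rewrite (metric_sym p x) xp pf => ? []; lra.
Qed.

End HyperbolicIsometry.

(** * Products with large powers of loxodromic elements *)

Section Loxodromic.
Context {R : realType} {G : groupType} {X : metricType R}.
Variable a : isometric_action G X.
Variable D : R.
Hypotheses (fp : four_point (X := X) D) (D0 : 0 < D).
Implicit Types (f g h : G) (x y z : X) (n : nat) (K t : R).

(* The two factors are g and g h^m, so that a common almost fixed point would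
   be moved a bounded distance by h^m. *)
Lemma loxodromic_mul_exp x h : geodesic_space X -> loxodromic a x h ->
  exists M, forall m g, (M <= m)%N -> ~ loxodromic a x g ->
    loxodromic a x (g * h ^+ m)%g \/ loxodromic a x (g ^+ 2 * h ^+ m)%g.
Proof.
move=> geo /loxodromic_displacement[c c0 ch].
have D_gt0 := D0; have D_ge0 := ltW D0.
(* The displacement of [h ^+ m] is at least [c * m], but a point moved at most [30 * D] by both [g]
   and [g * h ^+ m] is moved at most [60 * D] by [h ^+ m]. *)
exists (Num.truncn (60 * D / c)).+1 => m g Mm ng.
have [|n1] := pselect (loxodromic a x (g * h ^+ m)%g); first by left.
have [|n2] := pselect (loxodromic a x (g ^+ 2 * h ^+ m)%g); first by right.
have sg := short_squareP fp D_ge0 ng; have s1 := short_squareP fp D_ge0 n1.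
have := short_squareP fp D_ge0 n2; rewrite expg2 -mulgA => s2.
have [y yg] := near_common_fixed_point fp D_ge0 x geo D0 sg s1 s2.
rewrite actM; have := ch m y;
  have := metric_triangle (a g (a (h ^+ m)%g y)) y (a g y).
rewrite act_isometry (metric_sym y).
have : 60 * D / c < m%:R.
  by apply: lt_le_trans (truncnS_gt _) _; rewrite ler_nat.
by rewrite ltr_pdivrMr// mulrC; lra.
Qed.

(** Otherwise the displacement of [g ^+ (2 ^ i)] would be at most linear in [i], against exponential
    growth. The contradiction is taken at [i = e + e], where [2 ^ e >= e] already gives a quadratic
    lower bound. *)
Lemma loxodromic_doubling x g K : loxodromic a x g ->
  exists2 p, (0 < p)%N &
    mdist (a (g ^+ p)%g x) x + K <= mdist (a (g ^+ (2 * p))%g x) x.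
Proof.
move=> [c [B [c0 cB]]]; apply: contrapT => nex.
wlog K0 : K nex / 0 <= K.
  move=> W; apply: (W `|K|); last exact: normr_ge0.
  move=> [p p0 pK]; apply: nex; exists p => //; apply: le_trans pK.
  by rewrite lerD2l ler_norm.
have lt p : (0 < p)%N ->
    mdist (a (g ^+ (2 * p))%g x) x < mdist (a (g ^+ p)%g x) x + K.
  by move=> p0; rewrite ltNge; apply/negP => pK; apply: nex; exists p.
have pow i : mdist (a (g ^+ (2 ^ i))%g x) x <= mdist (a g x) x + i%:R * K.
  elim: i => [|i IHi]; first by rewrite expn0 expg1 mul0r addr0.
  have := lt (2 ^ i)%N; rewrite expn_gt0 /= expnS => /(_ isT).
  by rewrite -natr1; lra.
have B0 : 0 <= B by have := cB 0; rewrite expg0 act1 mdistxx; lra.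
have A0 := mdist_ge0 (a g x) x.
set b := B + mdist (a g x) x + 2 * K.
have := truncnS_gt (b / c); set e := (Num.truncn _).+1.
rewrite ltr_pdivrMr// => be.
have := pow (e + e)%N; have := cB (2 ^ (e + e))%N; rewrite expnD natrM natrD.
have le2 : e%:R <= (2 ^ e)%:R :> R by rewrite ler_nat ltnW// ltn_expl.
have e1 : 1 <= e%:R :> R by rewrite ler1n.
have : c * (e%:R * e%:R) <= c * ((2 ^ e)%:R * (2 ^ e)%:R).
  by rewrite ler_pM2l// ler_pM.
have : e%:R * b < c * (e%:R * e%:R).
  by rewrite mulrCA ltr_pM2l ?(mulrC c)//; lra.
have : 1 * (B + mdist (a g x) x) <= e%:R * (B + mdist (a g x) x).
  by rewrite ler_wpM2r//; lra.
by rewrite /b; lra.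
Qed.

(** Each further power gains at least [D + 1]. Based at [g ^+ (i + j) x], one alternative of
    [four_point] would bound the sum of two such gains by [2 * D]; the other gives the claim. *)
Lemma loxodromic_long_square_additive x g :
  mdist (a g x) x + 3 * D + 1 <= mdist (a (g ^+ 2)%g x) x ->
  forall i j, mdist (a (g ^+ i)%g x) x + mdist (a (g ^+ j)%g x) x <=
    mdist (a (g ^+ (i + j))%g x) x + (mdist (a g x) x + 2 * D).
Proof.
move=> gap i j; have D_gt0 := D0; have A0 := mdist_ge0 (a g x) x.
have growth n : mdist (a (g ^+ n)%g x) x + (D + 1) <= mdist (a (g ^+ n.+1)%g x)
  x.
  case: n => [|n]; last by apply: (mdist_exp_growth fp); lra.
  by have := mdist_expS a g x 1; rewrite expg0 act1 mdistxx expg1; lra.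
case: j => [|j]; first by rewrite addn0 expg0 act1 mdistxx; lra.
have := fp (a (g ^+ (i + j.+1))%g x) x (a (g ^+ i)%g x) (a (g ^+ i.+1)%g x).
rewrite /gromov_product (metric_sym x) (metric_sym _ (a (g ^+ (i + j.+1))%g x)).
rewrite mdist_expD.
have -> : mdist (a (g ^+ i.+1)%g x) (a (g ^+ (i + j.+1))%g x) = mdist (a (g ^+
  j)%g x) x.
  by rewrite metric_sym -addSnnS mdist_expD.
rewrite (metric_sym (a (g ^+ i)%g x)) -[i.+1]addn1 mdist_expD addn1.
rewrite !(metric_sym x).
have := growth i; have := growth j; rewrite expg1.
by move=> ? ? []; lra.
Qed.

(** The orbit does not backtrack: it is a quasi-geodesic. Some [g ^+ p] has a long square, and the
    remainders of [i] and [j] modulo [p] are each paid for twice, whence the factor 4. *)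
Lemma loxodromic_additive x g : loxodromic a x g -> exists C, forall i j,
  mdist (a (g ^+ i)%g x) x + mdist (a (g ^+ j)%g x) x <=
    mdist (a (g ^+ (i + j))%g x) x + C.
Proof.
move=> /(loxodromic_doubling (3 * D + 1))[p p0]; rewrite addrA mulnC expgnA.
move=> /loxodromic_long_square_additive add.
exists (mdist (a (g ^+ p)%g x) x + 2 * D + 4 * (p%:R * mdist (a g x) x)) => i j.
have le r : (r < p)%N -> mdist (a (g ^+ r)%g x) x <= p%:R * mdist (a g x) x.
  move=> rp; apply: le_trans (mdist_exp_le _ _ _ _) _.
  by rewrite ler_wpM2r ?mdist_ge0// ler_nat ltnW.
have up m n : mdist (a (g ^+ (m + n))%g x) x <=
    mdist (a (g ^+ m)%g x) x + mdist (a (g ^+ n)%g x) x.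
  have := metric_triangle (a (g ^+ (m + n))%g x) (a (g ^+ m)%g x) x.
  by rewrite mdist_expD; lra.
have lo m n : mdist (a (g ^+ m)%g x) x <=
    mdist (a (g ^+ (m + n))%g x) x + mdist (a (g ^+ n)%g x) x.
  have := metric_triangle (a (g ^+ m)%g x) (a (g ^+ (m + n))%g x) x.
  by rewrite [mdist (a (g ^+ m)%g x) (a _ x)]metric_sym mdist_expD; lra.
have := le _ (ltn_pmod i p0); have := le _ (ltn_pmod j p0).
rewrite {2 3}(divn_eq i p) {2 3}(divn_eq j p).
set q := (i %/ p)%N; set r := (i %% p)%N.
set q' := (j %/ p)%N; set r' := (j %% p)%N => lr' lr.
have := up (q * p)%N r; have := up (q' * p)%N r'; have := up r r'.
have := lo (q * p + q' * p)%N (r + r')%N.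
rewrite addnACA; have := add q q'; rewrite -!expgnA ![(p * _)%N]mulnC mulnDl.
by lra.
Qed.

(* The geometric content is that f sends the attracting fixed point of g to
   the repelling one. *)
Definition swaps_ends x g f : Prop := exists M, forall n,
  mdist (a f (a (g ^+ n)%g x)) (a (g ^- n)%g x) <= M.

(** The right side is the product of [y] and [z] based at [f^-1 x], and a product changes by at most
    the distance its base point moves. *)
Lemma gromov_product_act x y z f :
  gromov_product x y z - mdist (a f x) x <= gromov_product x (a f y) (a f z).
Proof.
have := metric_triangle y x (a f^-1%g x);
  have := metric_triangle z x (a f^-1%g x).
have := metric_triangle y (a f^-1%g x) x;
  have := metric_triangle z (a f^-1%g x) x.
rewrite (metric_sym x (a f^-1%g x)) mdist_inv /gromov_product act_isometry.
rewrite !(metric_sym _ (a f^-1%g x)) !mdist_actV !(metric_sym x (a f _)).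
by lra.
Qed.

(** One large product makes the paths to [f g^n x] and [g^-n x] fellow-travel. By quasi-additivity
    [f g^j x] and [g^-j x] lie near these paths, at comparable distances from [x], hence near each
    other. *)
Lemma swaps_ends_of_large_product x g f : loxodromic a x g ->
  (forall K, exists n,
     K < gromov_product x (a f (a (g ^+ n)%g x)) (a (g ^- n)%g x)) ->
  swaps_ends x g f.
Proof.
move=> /loxodromic_additive[C addC] large; have D_gt0 := D0.
exists (C + 3 * mdist (a f x) x + 4 * D) => j.
have A0 := mdist_ge0 (a g x) x; have F0 := mdist_ge0 (a f x) x.
(* This threshold forces [j <= n] and bounds the distance from [x] to [g^j x]. *)
have [n] := large (j%:R * mdist (a g x) x); rewrite gromov_productC => nlarge.
have jn : (j <= n)%N.
  rewrite leqNgt; apply/negP => nj.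
  have := gromov_product_le x (a (g ^- n)%g x) (a f (a (g ^+ n)%g x)).
  rewrite mdist_inv; have := mdist_exp_le a g x n.
  have : n%:R * mdist (a g x) x <= j%:R * mdist (a g x) x.
    by rewrite ler_wpM2r// ler_nat ltnW.
  by lra.
have aj := mdist_exp_le a g x j.
have C0 : 0 <= C by have := addC 0 0; rewrite addn0 expg0 act1 mdistxx; lra.
have gpj : mdist (a (g ^+ j)%g x) x - 2^-1 * C <=
    gromov_product x (a (g ^+ j)%g x) (a (g ^+ n)%g x).
  have := addC j (n - j)%N; rewrite subnKC// /gromov_product.
  have -> : mdist (a (g ^+ j)%g x) (a (g ^+ n)%g x) = mdist (a (g ^+ (n - j))%g
    x) x.
    by rewrite -[in LHS](subnKC jn) metric_sym mdist_expD.
  by lra.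
have gpjV : mdist (a (g ^+ j)%g x) x - 2^-1 * C <=
    gromov_product x (a (g ^- j)%g x) (a (g ^- n)%g x).
  have := addC j (n - j)%N; rewrite subnKC// /gromov_product !mdist_inv.
  have -> : (g ^- n = g ^- j * g ^- (n - j))%g by rewrite -invgM -expgnDr subnK.
  rewrite actM (metric_sym (a (g ^- j)%g x)) act_isometry mdist_inv.
  by lra.
have := gromov_product_act x (a (g ^+ j)%g x) (a (g ^+ n)%g x) f => fgpj.
have le1 : mdist (a (g ^+ j)%g x) x - 2^-1 * C - mdist (a f x) x - 2 * D <=
    gromov_product x (a f (a (g ^+ j)%g x)) (a (g ^- j)%g x).
  have [|] := fp x (a f (a (g ^+ j)%g x)) (a f (a (g ^+ n)%g x)) (a (g ^- j)%g
    x).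
    by lra.
  rewrite (gromov_productC x (a f (a (g ^+ n)%g x))).
  have [|] := fp x (a (g ^- j)%g x) (a (g ^- n)%g x) (a f (a (g ^+ n)%g x));
    lra.
move: le1; rewrite {1}/gromov_product mdist_inv.
have := metric_triangle (a f (a (g ^+ j)%g x)) (a f x) x; rewrite act_isometry.
by lra.
Qed.

(** The products of [f g^n x] and [g^-n x] are bounded, so [(g^n f)^2] moves [x] by about twice what
    [g^n] does, while [g^n f] moves it about once as much: the square is long for large [n]. *)
Lemma loxodromic_exp_mul x g f : loxodromic a x g -> ~ swaps_ends x g f ->
  exists N, forall n, (N <= n)%N -> loxodromic a x (g ^+ n * f)%g.
Proof.
move=> lg nsw; have D_gt0 := D0.
have [K leK] : exists K, forall n,
    gromov_product x (a f (a (g ^+ n)%g x)) (a (g ^- n)%g x) <= K.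
  apply: contrapT => nex; apply: nsw;
    apply: swaps_ends_of_large_product => // K.
  apply: contrapT => nK; apply: nex; exists K => n; rewrite leNgt;
    apply/negP => lt.
  by apply: nK; exists n.
have [c [B [c0 cB]]] := lg.
exists (Num.truncn ((2 * K + 3 * mdist (a f x) x + 2 * D + B) / c)).+1 => n Nn.
have : (2 * K + 3 * mdist (a f x) x + 2 * D + B) / c < n%:R.
  by apply: lt_le_trans (truncnS_gt _) _; rewrite ler_nat.
rewrite ltr_pdivrMr// => {}Nn.
apply: (loxodromic_of_long_square fp); first exact: ltW.
have := leK n; have := cB n; rewrite /gromov_product mdist_inv.
have -> : mdist (a ((g ^+ n * f) ^+ 2)%g x) x =
    mdist (a f (a (g ^+ n)%g (a f x))) (a (g ^- n)%g x).
  by rewrite [RHS]metric_sym mdist_actV [RHS]metric_sym -!actM expg2 !mulgA.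
have := metric_triangle (a f (a (g ^+ n)%g x)) (a f (a (g ^+ n)%g (a f x))) (a
  (g ^- n)%g x).
rewrite !act_isometry (metric_sym x (a f x)).
have := metric_triangle (a (g ^+ n * f)%g x) (a (g ^+ n)%g x) x.
rewrite [in mdist (a (_ * f)%g x) (a _ x)]actM act_isometry.
have := metric_triangle (a f (a (g ^+ n)%g x)) x (a f x).
rewrite act_isometry (metric_sym x (a f x)).
by lra.
Qed.

(** If [h^p] and [h^q] both swap, then [h^(q - p)] and its powers fix the attracting end and cannot
    swap, so [d = q - p]. If only [h^p] swaps, then [p] is nonzero and is no multiple of
    [d = p + 1]. *)
Lemma swaps_ends_exp x g h : loxodromic a x g ->
  exists2 d, (0 < d)%N & forall j, ~ swaps_ends x g (h ^+ (d * j))%g.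
Proof.
move=> [c [B [c0 cB]]].
pose fixes f := exists M, forall n,
  mdist (a f (a (g ^+ n)%g x)) (a (g ^+ n)%g x) <= M.
have fix_exp f j : fixes f -> fixes (f ^+ j)%g.
  move=> [M fM]; exists (j%:R * M) => n; elim: j => [|j IHj].
    by rewrite expg0 act1 mdistxx mul0r.
  have := mdist_expS a f (a (g ^+ n)%g x) j; have := fM n; rewrite -natr1; lra.
have swap_fix f : swaps_ends x g f -> ~ fixes f.
  move=> [M fM] [M' fM'].
  have := truncnS_gt ((M + M' + B) / c); set n := (Num.truncn _).+1.
  have := cB (n + n)%N; rewrite expgnDr actM metric_sym -mdist_actV.
  have := fM n; have := fM' n.
  have := metric_triangle (a (g ^- n)%g x) (a f (a (g ^+ n)%g x)) (a (g ^+ n)%g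
    x).
  rewrite (metric_sym _ (a f _)) ltr_pdivrMr// natrD.
  have : 0 <= c * n%:R by rewrite mulr_ge0// ltW.
  by lra.
have not1 : ~ swaps_ends x g 1%g.
  by move=> s1; apply: (swap_fix _ s1); exists 0 => n; rewrite act1 mdistxx.
have swap_swap p q : (p < q)%N -> swaps_ends x g (h ^+ p)%g ->
    swaps_ends x g (h ^+ q)%g -> fixes (h ^+ (q - p))%g.
  move=> pq [M pM] [M' qM]; exists (M + M') => n.
  rewrite -(act_isometry a (h ^+ p)%g) -actM -expgnDr subnKC ?(ltnW pq)//.
  have := pM n; have := qM n.
  have := metric_triangle (a (h ^+ q)%g (a (g ^+ n)%g x)) (a (g ^- n)%g x)
    (a (h ^+ p)%g (a (g ^+ n)%g x)).
  by rewrite (metric_sym (a (g ^- n)%g x)); lra.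
have key p q : (p < q)%N -> swaps_ends x g (h ^+ p)%g ->
    swaps_ends x g (h ^+ q)%g ->
    exists2 d, (0 < d)%N & forall j, ~ swaps_ends x g (h ^+ (d * j))%g.
  move=> pq sp sq; exists (q - p)%N; first by rewrite subn_gt0.
  move=> j /swap_fix; apply; rewrite expgnA; apply: fix_exp.
  exact: swap_swap sp sq.
have [[p sp]|nosw] := pselect (exists p, swaps_ends x g (h ^+ p)%g); last first.
  by exists 1 => // j sj; apply: nosw; exists (1 * j)%N.
have [[q [qp sq]]|uniq] :=
    pselect (exists q, q <> p /\ swaps_ends x g (h ^+ q)%g); last first.
  exists p.+1 => // j sj; apply: uniq; exists (p.+1 * j)%N; split=> //.
  case: j sj => [|j] sj; first by rewrite muln0 expg0 in sj.
  by move=> /eqP; rewrite mulnS gtn_eqF// addSn ltnS leq_addr.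
by have [pq|qp'|/qp//] := ltngtP q p; [exact: (key q p)|exact: (key p q)].
Qed.

End Loxodromic.

Lemma card_set2 (T : Type) (x y : T) : x <> y -> [set x; y] #= `I_2.
Proof.
move=> xy; pose f n := if n is 0 then x else y.
have -> : [set x; y] = [set f n | n in `I_2].
  apply/seteqP; split=> [z [->|->]|_ [[|n] _ <-]];
    [|by exists 1|by left|by right].
  by exists 0.
by apply: inj_card_eq => -[|[|i]] [|[|j]]; rewrite !inE //= => _ _ e; case: xy;
  rewrite e.
Qed.

(** * Boundary points as classes of sequences *)

Section Boundary.
Context {R : realType} {X : metricType R}.
Variables (D : R) (o : X).
Hypothesis fp : four_point (X := X) D.
Implicit Types (u v w : nat -> X).

Lemma gromov_divergeP u v : gromov_diverge o u v <-> forall K, exists N,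
  forall m n, (N <= m)%N -> (N <= n)%N -> K <= gromov_product o (u m) (v n).
Proof.
split=> [/cvgryPge div K|div].
  have [[P Q] [[M _ MP] [N _ NQ]] PQ] := div K.
  exists (maxn M N) => m n; rewrite !geq_max => /andP[Mm _] /andP[_ Nn].
  by apply: (PQ (m, n)); split; [exact: MP|exact: NQ].
apply/cvgryPge => K; have [N NK] := div K.
exists ([set n | (N <= n)%N], [set n | (N <= n)%N]); first by split; exists N.
by move=> [m n] [/= Nm Nn]; exact: NK.
Qed.

Lemma gromov_diverge_sym u v : gromov_diverge o u v -> gromov_diverge o v u.
Proof.
move=> /gromov_divergeP div; apply/gromov_divergeP => K.
have [N NK] := div K; exists N => m n Nm Nn.
by rewrite gromov_productC; exact: NK.
Qed.

Lemma gromov_diverge_trans v u w :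
  gromov_diverge o u v -> gromov_diverge o v w -> gromov_diverge o u w.
Proof.
move=> /gromov_divergeP uv /gromov_divergeP vw; apply/gromov_divergeP => K.
have [M MK] := uv (K + D); have [N NK] := vw (K + D).
exists (maxn M N) => m n; rewrite !geq_max => /andP[Mm Nm] /andP[Mn Nn].
have := MK _ _ Mm Mm; have := NK _ _ Nm Nn.
by case: (fp o (u m) (v m) (w n)); lra.
Qed.

Lemma boundary_class_eqP u v : converges_at_infinity o u ->
  converges_at_infinity o v ->
  boundary_class o u = boundary_class o v <-> gromov_diverge o u v.
Proof.
move=> cu cv; split=> [uv|uv].
  have : boundary_class o v v by split.
  by rewrite -uv => -[].
apply/seteqP; split=> w [cw dw]; split=> //;
  apply: gromov_diverge_trans dw => //.
exact: gromov_diverge_sym.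
Qed.

(** A single large product far along the two sequences forces all later ones to be large, by two
    uses of [four_point]; so failure to diverge means a bounded tail. *)
Lemma not_gromov_diverge_bounded u v : converges_at_infinity o u ->
  converges_at_infinity o v -> ~ gromov_diverge o u v ->
  exists K N, forall m n, (N <= m)%N -> (N <= n)%N ->
    gromov_product o (u m) (v n) < K.
Proof.
move=> /gromov_divergeP cu /gromov_divergeP cv; apply: contra_notP => nb.
have D0 : 0 <= D by have := fp o o o o; lra.
apply/gromov_divergeP => K.
have [M MK] := cu (K + 2 * D); have [N NK] := cv (K + 2 * D).
have [m [n [[Mm Nn] mnK]]] : exists m n, ((M <= m)%N /\ (N <= n)%N) /\
    K + 2 * D <= gromov_product o (u m) (v n).
  apply: contrapT => nex; apply: nb; exists (K + 2 * D), (maxn M N) => m n.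
  rewrite !geq_max => /andP[Mm Nm] /andP[Mn Nn]; rewrite ltNge;
    apply/negP => le.
  by apply: nex; exists m, n.
exists (maxn M N) => m' n'; rewrite !geq_max => /andP[Mm' _] /andP[_ Nn'].
have := MK _ _ Mm' Mm; have := NK _ _ Nn Nn'.
have := fp o (u m') (u m) (v n'); have := fp o (u m) (v n) (v n').
by move=> [] ? []; lra.
Qed.

Lemma gromov_diverge_bounded u v K : converges_at_infinity o u ->
  (forall n, mdist (u n) (v n) <= K) -> gromov_diverge o u v.
Proof.
move=> /gromov_divergeP cu uv; apply/gromov_divergeP => L.
have [N NL] := cu (L + K); exists N => m n Nm Nn.
by have := NL _ _ Nm Nn; have := gromov_product_lip o (u m) (u n) (v n);
  have := uv n; lra.
Qed.

End Boundary.

(** * Loxodromic elements and their fixed points at infinity *)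

Section HyperbolicElement.
Context {R : realType} {G : groupType} {X : metricType R}.
Variable a : isometric_action G X.
Variables (D : R) (o : X).
Hypotheses (fp : four_point (X := X) D) (D0 : 0 < D).
Implicit Types (f g h : G) (u v w : nat -> X).

Lemma gromov_diverge_act f u v : gromov_diverge o u v ->
  gromov_diverge o (fun n => a f (u n)) (fun n => a f (v n)).
Proof.
move=> /gromov_divergeP uv; apply/gromov_divergeP => K.
have [N NK] := uv (K + mdist (a f o) o); exists N => m n Nm Nn.
by have := NK _ _ Nm Nn; have := gromov_product_act a o (u m) (v n) f; lra.
Qed.

Lemma boundary_act_class g u : boundary_act a g (boundary_class o u) =
  boundary_class o (fun n => a g (u n)).
Proof.
apply/seteqP; split=> [_ [v [cv uv] <-]|v [cv uv]].
  by split; exact: gromov_diverge_act.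
exists (fun n => a g^-1%g (v n)).
  split; first exact: gromov_diverge_act.
  have := gromov_diverge_act g^-1%g uv.
  by under eq_fun do rewrite -actM mulVg act1.
by apply/funext => n; rewrite -actM mulgV act1.
Qed.

Lemma boundary_class_fixed g u : converges_at_infinity o u ->
  boundary_act a g (boundary_class o u) = boundary_class o u <->
  gromov_diverge o u (fun n => a g (u n)).
Proof.
move=> cu; rewrite boundary_act_class; split=> [e|div].
  by apply/(boundary_class_eqP fp cu); [exact: gromov_diverge_act|].
by apply/esym/(boundary_class_eqP fp cu) => //; exact: gromov_diverge_act.
Qed.

Lemma loxodromic_far g K : loxodromic a o g ->
  exists N, forall n, (N <= n)%N -> K <= mdist (a (g ^+ n)%g o) o.
Proof.
move=> [c [B [c0 cB]]]; exists (Num.truncn ((K + B) / c)).+1 => n Nn.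
have : (K + B) / c < n%:R.
  by apply: lt_le_trans (truncnS_gt _) _; rewrite ler_nat.
by rewrite ltr_pdivrMr// mulrC; have := cB n; lra.
Qed.

Lemma loxodromicV g : loxodromic a o g -> loxodromic a o g^-1%g.
Proof.
move=> [c [B [c0 cB]]]; exists c, B; split=> // n.
by rewrite expVgn mdist_inv.
Qed.

Lemma loxodromic_converges g : loxodromic a o g ->
  converges_at_infinity o (fun n => a (g ^+ n)%g o).
Proof.
move=> lg; apply/gromov_divergeP => K.
have [C addC] := loxodromic_additive fp D0 lg.
have [N NK] := loxodromic_far (K + 2^-1 * C) lg; exists N => m n Nm Nn.
wlog mn : m n Nm Nn / (m <= n)%N.
  by move=> W; case/orP: (leq_total m n) => ?; [|rewrite gromov_productC];
    exact: W.
have := addC m (n - m)%N; rewrite subnKC// /gromov_product; have := NK m Nm.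
have -> : mdist (a (g ^+ m)%g o) (a (g ^+ n)%g o) = mdist (a (g ^+ (n - m))%g
  o) o.
  by rewrite -[in LHS](subnKC mn) metric_sym mdist_expD.
by lra.
Qed.

Lemma loxodromic_ends_neq g : loxodromic a o g ->
  ~ gromov_diverge o (fun n => a (g ^+ n)%g o) (fun n => a (g^-1 ^+ n)%g o).
Proof.
move=> lg /gromov_divergeP div; have [C addC] := loxodromic_additive fp D0 lg.
have [N] := div (C + 1); move=> /(_ N N (leqnn N) (leqnn N)).
have C0 : 0 <= C by have := addC 0 0; rewrite addn0 expg0 act1 mdistxx; lra.
rewrite /gromov_product expVgn mdist_inv (metric_sym _ (a (g ^- N)%g o))
  mdist_actV -actM -expgnDr.
by have := addC N N; rewrite (metric_sym o); lra.
Qed.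

(* If w were at bounded Gromov product from both ends, then g^k w would be
   close to the attracting end for large k, while g^k w = w on the boundary. *)
Lemma loxodromic_fixed_class g w : loxodromic a o g ->
  converges_at_infinity o w -> gromov_diverge o w (fun n => a g (w n)) ->
  gromov_diverge o (fun n => a (g ^+ n)%g o) w \/
  gromov_diverge o (fun n => a (g^-1 ^+ n)%g o) w.
Proof.
move=> lg cw gw; apply: contrapT => /not_orP[].
move=> /(not_gromov_diverge_bounded fp (loxodromic_converges lg) cw)[K1 [N1
  le1]].
move=> /(not_gromov_diverge_bounded fp (loxodromic_converges (loxodromicV lg))
  cw).
move=> [K2 [N2 le2]].
(* Then [g^k w] and [g^k o] have product above [K1 + D], since it is the displacement of [g^k] minus
   a product below [K2]. *)
have [N3 far] := loxodromic_far (K1 + K2 + D) lg.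
pose k := maxn N1 (maxn N2 N3).
have gkw : gromov_diverge o w (fun n => a (g ^+ k)%g (w n)).
  elim: k => [|j IHj]; first by under eq_fun do rewrite expg0 act1.
  have -> : (fun n => a (g ^+ j.+1)%g (w n)) =
      (fun n => a g ((fun n => a (g ^+ j)%g (w n)) n)).
    by apply/funext => n; rewrite expgS actM.
  by apply: (gromov_diverge_trans fp gw); exact: gromov_diverge_act.
have /gromov_divergeP/(_ (K1 + D))[N4 le4] := gkw.
pose n := maxn N1 (maxn N2 N4).
have [k1 k2 k3] : [/\ (N1 <= k)%N, (N2 <= k)%N & (N3 <= k)%N].
  by rewrite /k !leq_max !leqnn !orbT.
have [n1 n2 n4] : [/\ (N1 <= n)%N, (N2 <= n)%N & (N4 <= n)%N].
  by rewrite /n !leq_max !leqnn !orbT.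
have := le1 _ _ k1 n1; have := le2 _ _ k2 n2; have := le4 _ _ n4 n4;
  have := far _ k3.
have := fp o (w n) (a (g ^+ k)%g (w n)) (a (g ^+ k)%g o).
rewrite (gromov_productC o (a (g ^+ k)%g o) (w n)).
have -> : gromov_product o (a (g ^+ k)%g (w n)) (a (g ^+ k)%g o) =
    mdist (a (g ^+ k)%g o) o - gromov_product o (a (g^-1 ^+ k)%g o) (w n).
  rewrite /gromov_product act_isometry expVgn mdist_inv.
  rewrite (metric_sym (a (g ^- k)%g o)) -(mdist_actV a (g ^- k)%g) invgK.
  by lra.
by case; lra.
Qed.

Lemma loxodromic_hyperbolic g : loxodromic a o g -> hyperbolic_element a o g.
Proof.
move=> lg; have lgV := loxodromicV lg.
have cu := loxodromic_converges lg; have cv := loxodromic_converges lgV.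
split.
  move=> /(_ o)[M leM]; have [N farN] := loxodromic_far (M + 1) lg.
  have := farN N (leqnn N); have : mdist (a (g ^+ N)%g o) (a 1%g o) <= M.
    by apply: leM; [exists N; left | exists 0; left].
  by rewrite act1; lra.
(* Used with [f = g] and [f = g^-1]: moving the orbit a bounded distance, [g] fixes both ends. *)
have near f n : commute g f ->
    mdist (a (f ^+ n)%g o) (a g (a (f ^+ n)%g o)) <= mdist (a g o) o.
  move=> gf; rewrite -actM (_ : g * f ^+ n = f ^+ n * g)%g;
    last exact: commuteX.
  by rewrite actM act_isometry metric_sym.
have -> : boundary_fixed_points a o g =
    [set boundary_class o (fun n => a (g ^+ n)%g o);
         boundary_class o (fun n => a (g^-1 ^+ n)%g o)].
  apply/seteqP; split=> [_ [[w cw <-]] /(boundary_class_fixed _ cw) gw|xi].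
    by have [|] := loxodromic_fixed_class lg cw gw; [left|right];
      apply/esym/(boundary_class_eqP fp).
  case=> ->; (split; first by eexists; [|reflexivity]);
    apply/boundary_class_fixed => //;
    apply: (gromov_diverge_bounded (K := mdist (a g o) o)) => // n; apply: near.
    exact: commute_refl.
  exact: commuteV.
by apply: card_set2 => /(boundary_class_eqP fp cu cv);
  exact: loxodromic_ends_neq.
Qed.

(** Two distinct limit points provide [f n] and [h n] with large displacements and bounded mutual
    product. Were nothing loxodromic, all squares would be short, and [ping_pong] would contradict
    this for [f n * h n]. *)
Lemma exists_loxodromic :
  ~ elliptic_action a o -> ~ horocyclic_action a o -> exists g, loxodromic a o
    g.
Proof.
rewrite /elliptic_action II0 card_eq0 => /negP/set0P[xi xiL] nhor.
have [eta etaL neq] : exists2 eta, limit_set a o eta & eta <> xi.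
  apply: contrapT => nex; apply: nhor; rewrite /horocyclic_action.
  suff -> : limit_set a o = [set xi] by exact: card_set1.
  apply/seteqP; split=> [eta etaL|_ ->//]; apply: contrapT => neq.
  by apply: nex; exists eta.
have [u [cu [f fu]] uxi] := xiL; have [v [cv [h hv]] veta] := etaL.
have D_gt0 := D0.
apply: contrapT => nlox.
have short g : short_square a D g.
  by apply: (short_squareP (x := o) fp (ltW D0)) => lg; apply: nlox; exists g.
have nuv : ~ gromov_diverge o u v.
  move=> /(boundary_class_eqP fp cu cv) e.
  by apply: neq; rewrite -uxi -veta.
have [K [N leK]] := not_gromov_diverge_bounded fp cu cv nuv.
have /gromov_divergeP/(_ (2 * K + 5 * D))[N1 far1] := cu.
have /gromov_divergeP/(_ (2 * K + 5 * D))[N2 far2] := cv.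
pose n := maxn N (maxn N1 N2).
have [n0 n1 n2] : [/\ (N <= n)%N, (N1 <= n)%N & (N2 <= n)%N].
  by rewrite /n !leq_max !leqnn !orbT.
have := far1 _ _ n1 n1; have := far2 _ _ n2 n2; have := leK _ _ n0 n0.
rewrite fu hv => lt hbig fbig.
have := short (f n * h n)%g o; rewrite leNgt => /negP; apply.
apply: (ping_pong fp (ltW D0) (short _) (short _) lt).
  exact: le_trans fbig (gromov_product_le _ _ _).
exact: le_trans hbig (gromov_product_le _ _ _).
Qed.

End HyperbolicElement.

Lemma gromov_hyperbolic_four_point (R : realType) (X : metricType R) :
  gromov_hyperbolic X -> exists2 D, 0 < D & four_point (X := X) D.
Proof.
move=> [geo [delta delta0 /(delta_hyperbolic_four_point geo) fp]].
(* Adding 1 makes the constant positive even for [delta = 0]. *)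
exists (3 * delta + 1) => [|o x y z]; first by lra.
by case: (fp o x y z); [left|right]; lra.
Qed.

(** * Combination over finitely many spaces *)

Section Simultaneous.
Context {R : realType} {l : nat} {G : groupType}.
Variables (X : 'I_l -> metricType R) (x0 : forall i, X i).
Variable a : forall i, isometric_action G (X i).
Hypothesis hX : forall i, gromov_hyperbolic (X i).
Implicit Types (s : seq 'I_l) (i : 'I_l).

Let lox i g := loxodromic (a i) (x0 i) g.

(** The product of the exponents found on each space works, its multiples being multiples of every
    one of them. *)
Lemma swaps_ends_exp_all s g h : (forall i, i \in s -> lox i g) ->
  exists2 d, (0 < d)%N &
    forall i j, i \in s -> ~ swaps_ends (a i) (x0 i) g (h ^+ (d * j))%g.
Proof.
elim: s => [|k s IHs] lg; first by exists 1.
have [d d0 dsw] := IHs (fun i is_ => lg i (@mem_behead _ (k :: s) i is_)).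
have [e e0 esw] := swaps_ends_exp h (lg k (mem_head k s)).
exists (d * e)%N => [|i j]; first by rewrite muln_gt0 d0.
rewrite inE => /predU1P[->|/dsw]; last by rewrite -mulnA; exact.
by rewrite (mulnC d) -mulnA; exact: esw.
Qed.

Lemma loxodromic_exp_mul_all s g f : (forall i, i \in s -> lox i g) ->
  (forall i, i \in s -> ~ swaps_ends (a i) (x0 i) g f) ->
  exists N, forall n i, (N <= n)%N -> i \in s -> lox i (g ^+ n * f)%g.
Proof.
elim: s => [|k s IHs] lg sw; first by exists 0.
have [|i is_|N NP] := IHs.
- by move=> i is_; apply: lg; rewrite inE is_ orbT.
- by apply: sw; rewrite inE is_ orbT.
have [D D0 fp] := gromov_hyperbolic_four_point (hX k).
have [M MP] := loxodromic_exp_mul fp D0 (lg k (mem_head k s)) (sw k (mem_head k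
  s)).
exists (maxn M N) => n i; rewrite geq_max inE => /andP[Mn Nn] /predU1P[->|].
  exact: MP.
exact: NP.
Qed.

(* With g loxodromic on the spaces in s but not on X k, and h loxodromic on
   X k, one of g^n h^m and g^(2n) h^m is loxodromic on all of them, for a
   suitable m and then n large. *)
Lemma exists_simultaneously_loxodromic s :
  (forall i, exists h, lox i h) -> exists g, forall i, i \in s -> lox i g.
Proof.
move=> exlox; elim: s => [|k s [g lg]]; first by exists 1%g.
have [lkg|nkg] := pselect (lox k g).
  by exists g => i; rewrite inE => /predU1P[->|/lg].
have [h lh] := exlox k; have [D D0 fp] := gromov_hyperbolic_four_point (hX k).
have [M MP] := loxodromic_mul_exp fp D0 (proj1 (hX k)) lh.
have [d d0 dsw] := swaps_ends_exp_all h lg.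
(* The exponent [d * M] serves both purposes: as a multiple of [d] it avoids swaps on [s], and it is
   at least [M], as needed on [X k]. *)
have [N NP] := loxodromic_exp_mul_all lg (fun i => dsw i M).
(* The successor keeps the exponent positive, as [loxodromic_root] requires. *)
have ngN : ~ lox k (g ^+ N.+1)%g by move=> /(loxodromic_root (ltn0Sn N)).
have leN : (N <= N.+1 * 2)%N by rewrite muln2 -addnn addSn ltnW// ltnS leq_addr.
have [lk|lk] := MP (d * M)%N _ (leq_pmull M d0) ngN.
  by exists (g ^+ N.+1 * h ^+ (d * M))%g => i;
    rewrite inE => /predU1P[->//|/NP]; exact.
exists (g ^+ (N.+1 * 2) * h ^+ (d * M))%g => i.
rewrite inE => /predU1P[->|/NP]; last exact.
by rewrite expgnA.
Qed.

End Simultaneous.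

Theorem theorem1p1 (R : realType) (l : nat) (hl : (1 <= l)%N) (G : groupType)
  (X : 'I_l -> metricType R) (x0 : forall i : 'I_l, X i)
  (a : forall i : 'I_l, isometric_action G (X i))
  (hX : forall i : 'I_l, gromov_hyperbolic (X i))
  (hell : forall i : 'I_l, ~ elliptic_action (a i) (x0 i))
  (hhor : forall i : 'I_l, ~ horocyclic_action (a i) (x0 i)) :
  simultaneously_hyperbolic a x0 !=set0.
Proof.
have [|g lg] := @exists_simultaneously_loxodromic R l G X x0 a hX (enum 'I_l).
  move=> i; have [D D0 fp] := gromov_hyperbolic_four_point (hX i).
  exact: exists_loxodromic fp D0 (hell i) (hhor i).
exists g => i; have [D D0 fp] := gromov_hyperbolic_four_point (hX i).
by apply: (loxodromic_hyperbolic fp D0); apply: lg; rewrite mem_enum.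
Qed.
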